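(* Let $H$ be a Hilbert space and let $E,A\in L(H)$ be bounded linear operators such that the pair $(E,A)$ is regular. Let $k=\operatorname{ind}(E,A)$ and assume that $E[\mathrm{IV}_{k}]\subseteq H$ is closed. Then $\mathrm{IV}_{k+1}=\mathrm{IV}_{k+2}$.
   Context: $H$ is a complex Hilbert space (possibly infinite-dimensional), $L(H)$ is the space of bounded linear operators on $H$, and $\mathbb{N}$ contains $0$. For $\nu_0\in\mathbb{R}$, $\mathbb{C}_{\operatorname{Re}>\nu_0}=\{s\in\mathbb{C}: \operatorname{Re}s>\nu_0\}$. For $E,A\in L(H)$ put $\rho(E,A)=\{s\in\mathbb{C}: (sE+A)^{-1}\in L(H)\}$. The pair $(E,A)$ is called regular if there is $\nu_0\in\mathbb{R}$ with $\mathbb{C}_{\operatorname{Re}>\nu_0}\subseteq\rho(E,A)$ and there exist $C\geq 0$, $k\in\mathbb{N}$ such that $\|(sE+A)^{-1}\|\leq C|s|^{k}$ for all $s\in\mathbb{C}_{\operatorname{Re}>\nu_0}$. With such a $\nu_0$ fixed, the index is $$\operatorname{ind}(E,A)=\min\{k\in\mathbb{N}: \exists C\geq 0\ \forall s\in\mathbb{C}_{\operatorname{Re}>\nu_0}:\ \|(sE+A)^{-1}\|\leq C|s|^{k}\}.$$ The initial value spaces are defined by $\mathrm{IV}_0=H$ and $\mathrm{IV}_{j+1}=\{x\in H: Ax\in E[\mathrm{IV}_j]\}$ for $j\in\mathbb{N}$, where $E[V]=\{Ev: v\in V\}$. *)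

(* Defs.v *)
From HB Require Import structures.
From mathcomp Require Import all_boot all_order all_algebra.
From mathcomp Require Import complex.
From mathcomp Require Import all_classical all_reals all_analysis.

Set Implicit Arguments.
Unset Strict Implicit.
Unset Printing Implicit Defensive.

Import Order.TTheory GRing.Theory Num.Theory.
Import numFieldNormedType.Exports.

Local Open Scope classical_set_scope.
Local Open Scope ring_scope.

(* For V : normedZmodType R[i] the library norm `|x| takes its values in R[i]
   (it is a nonnegative real there); rnorm x is the same norm as an element
   of R. It applies both to vectors and to complex numbers. *)
Definition rnorm (R : realType) (V : normedZmodType R[i]) (x : V) : R :=
  complex.Re `|x|.

(* A Hilbert space is a complete normed module H over R[i] whose norm comes
   from a positive definite Hermitian form. *)
Definition induces_norm (R : realType) (H : normedModType R[i])
    (dot : {dot H for @Num.conj R[i]}) : Prop :=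
  forall x : H, dot x x = `|x| ^+ 2.

Section LinearPencils.
Context {R : realType} {H : normedModType R[i]}.
Implicit Types (T E A : H -> H) (s : R[i]) (nu : R) (k j : nat).

(* T \in L(H); see linear_boundedP and linear_bounded_continuous for the
   equivalence of bounded_near _ (nbhs 0) with the usual estimate and with
   continuity. *)
Definition bounded_operator T : Prop := linear T /\ bounded_near T (nbhs (0 : H)).

Definition opnorm T : R := sup [set rnorm (T x) | x in [set x : H | rnorm x <= 1]].

Definition pencil E A s : H -> H := fun x => s *: E x + A x.

(* The two-sided inverse of pencil E A s when the latter is bijective, and an
   unspecified function otherwise. *)
Definition resolvent E A s : H -> H := 'pinv_(fun=> 0) setT (pencil E A s).

Definition rho E A : set R[i] :=
  [set s | bijective (pencil E A s) /\ bounded_operator (resolvent E A s)].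

Definition half_plane nu : set R[i] := [set s | nu < complex.Re s].

(* The exponents k admissible in the resolvent estimate on Re s > nu. *)
Definition growth_exponents E A nu : set nat :=
  [set k | exists2 C : R, 0 <= C & forall s, half_plane nu s ->
           opnorm (resolvent E A s) <= C * rnorm s ^+ k].

Definition regular_on E A nu : Prop :=
  half_plane nu `<=` rho E A /\ growth_exponents E A nu !=set0.

Definition regular E A : Prop := exists nu, regular_on E A nu.

(* The minimum of growth_exponents E A nu, which exists as soon as
   regular_on E A nu (the default value 0 is never used in that case).
   A priori it depends on nu. *)
Definition ind E A nu : nat :=
  xget 0%N [set k | growth_exponents E A nu k /\
                    forall j, growth_exponents E A nu j -> (k <= j)%N].

Fixpoint IV E A j : set H :=
  if j is j'.+1 then [set x | (E @` IV E A j') (A x)] else setT.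

End LinearPencils.

(* Main.v *)
From HB Require Import structures.
Require Import Defs.
From mathcomp Require Import all_boot all_order all_algebra.
From mathcomp Require Import complex.
From mathcomp Require Import all_classical all_reals all_analysis.
From mathcomp Require Import ring lra.

Set Implicit Arguments.
Unset Strict Implicit.
Unset Printing Implicit Defensive.

Import Order.TTheory GRing.Theory Num.Theory.
Import numFieldNormedType.Exports.
Local Open Scope classical_set_scope.
Local Open Scope ring_scope.

(** Let [x] be in [IV (k+1)], so that [A x = E y] with [y] in [IV k]; the task
    is to find a preimage of [E y] under [E] that lies in [IV (k+1)]. For [s]
    in the half-plane put [w_s = s R(s) E y], where [R(s)] is the inverse of
    [s E + A]. Three facts show that the [w_s] converge weakly, along a
    sequence [s -> +oo], to such a preimage.

    - [w_s] lies in [IV (k+1)] ([pencil_IV]): the vector [v = R(s) E y]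
      satisfies [A v = E (y - s v)], so whenever [y] and [v] are in [IV j], the
      vector [v] is in [IV (j+1)].

    - The [w_s] stay bounded as [s -> +oo] ([resolvent_IV_growth]): one has
      [s R(s) E x = x - R(s) A x], and if [A x = E u] then the last term is
      [R(s) E u], which has one factor [s] less. Each step down the chain of
      initial value spaces therefore gains a power of [s], and [k] steps
      absorb the growth [|s|^k] of the resolvent.

    - [E w_s] tends to [E y], because [E w_s - E y = - A R(s) E y] has norm of
      order [1/|s|] ([resolvent_IV_approx]).

    As [E[IV k]] is closed, so is its preimage [IV (k+1)] under [A]; being a
    closed subspace, it contains the weak limit [w] of a sequence of [w_s], and
    [E w = E y]. The weak compactness used here is replaced by an elementary
    argument: [bounded_convex_closure_meet] says that, in a Hilbert space, the
    closures of a decreasing family of convex sets that all meet a fixed ball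
    have a common point, which is found as a limit of vectors of almost minimal
    norm. It is applied to the sets of [w] in [IV (k+1)] with
    [|E w - E y| < e]. *)

(** * The real-valued norm *)

Lemma rnormE (R : realType) (V : normedZmodType R[i]) (x : V) :
  `|x| = (rnorm x)%:C%C.
Proof. by rewrite /rnorm RRe_real ?normr_real. Qed.

Lemma rnorm_ge0 (R : realType) (V : normedZmodType R[i]) (x : V) :
  0 <= rnorm x.
Proof. by rewrite -ler0c -rnormE. Qed.

Lemma rnorm0_eq0 (R : realType) (V : normedZmodType R[i]) (x : V) :
  rnorm x = 0 -> x = 0.
Proof. by move=> x0; apply/normr0_eq0; rewrite rnormE x0. Qed.

Lemma rnorm0 (R : realType) (V : normedZmodType R[i]) : rnorm (0 : V) = 0.
Proof. by rewrite /rnorm normr0. Qed.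

Lemma ler_rnormD (R : realType) (V : normedZmodType R[i]) (x y : V) :
  rnorm (x + y) <= rnorm x + rnorm y.
Proof. by rewrite -lecR rmorphD /= -!rnormE ler_normD. Qed.

Lemma rnormN (R : realType) (V : normedZmodType R[i]) (x : V) :
  rnorm (- x) = rnorm x.
Proof. by rewrite /rnorm normrN. Qed.

Lemma ler_rnormB (R : realType) (V : normedZmodType R[i]) (x y : V) :
  rnorm (x - y) <= rnorm x + rnorm y.
Proof. by rewrite -(rnormN y) ler_rnormD. Qed.

Lemma rnormZ (R : realType) (V : normedModType R[i]) (s : R[i]) (x : V) :
  rnorm (s *: x) = rnorm s * rnorm x.
Proof.
by apply: complexI; rewrite rmorphM /= -!rnormE normrZ.
Qed.

Lemma rnorm_real (R : realType) (t : R) : rnorm (t%:C)%C = `|t|.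
Proof. by rewrite /rnorm normc_def /= expr0n addr0 sqrtr_sqr. Qed.

Lemma rnorm_half (R : realType) (V : normedModType R[i]) (x : V) :
  rnorm (2^-1 *: x) = rnorm x / 2.
Proof.
rewrite rnormZ mulrC (_ : 2^-1 = ((2^-1 : R)%:C)%C) ?rnorm_real ?ger0_norm//.
by rewrite fmorphV rmorph_nat.
Qed.

Lemma nbhs_rnormP (R : realType) (V : normedModType R[i]) (x : V) (U : set V) :
  nbhs x U <-> exists2 e : R, 0 < e & forall y, rnorm (x - y) < e -> U y.
Proof.
split.
  move=> /nbhs_normP[e /= e0 xeU].
  have eE : e = (complex.Re e)%:C%C by rewrite RRe_real ?gtr0_real.
  exists (complex.Re e); first by rewrite -ltcR -eE.
  by move=> y yx; apply: xeU; rewrite /= rnormE eE ltcR.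
move=> [e e0 xeU]; apply/nbhs_normP; exists (e%:C)%C; rewrite /= ?ltcR//.
by move=> y /=; rewrite rnormE ltcR; apply: xeU.
Qed.

Lemma rnorm_parallelogram (R : realType) (H : normedModType R[i])
    (dot : {dot H for @Num.conj R[i]}) (dot_norm : induces_norm dot) (x y : H) :
  rnorm (x + y) ^+ 2 + rnorm (x - y) ^+ 2 =
  2 * (rnorm x ^+ 2 + rnorm y ^+ 2).
Proof.
apply: complexI.
rewrite rmorphM !rmorphD !rmorphXn /= -!rnormE -!dot_norm.
rewrite dnormD dnormB rmorph1.
ring.
Qed.

(** * Bounded decreasing families of convex sets *)

(** This stands in for weak compactness of balls. Let [d] be the least radius
    such that every larger ball about 0 meets all the [B e]. For small [e] the
    points of [B e] have norm at least about [d]; two of them whose norms are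
    at most about [d] have a midpoint in [B e], of norm again at least about
    [d], so by the parallelogram law they are close to each other. Completeness
    then gives the common limit. *)
Lemma bounded_convex_closure_meet (R : realType) (H : completeNormedModType R[i])
    (dot : {dot H for @Num.conj R[i]}) (dot_norm : induces_norm dot)
    (B : R -> set H) (M : R)
    (B_mono : forall e f, e <= f -> B e `<=` B f)
    (B_mid : forall e x y, B e x -> B e y -> B e (2^-1 *: (x + y)))
    (B_bounded : forall e, 0 < e -> exists2 x, B e x & rnorm x <= M) :
  exists w, forall e, 0 < e -> closure (B e) w.
Proof.
pose S := [set r : R | 0 <= r /\
  forall e, 0 < e -> exists2 x, B e x & rnorm x <= r].
have SM : S M.
  split=> //; have [x _] := B_bounded _ (@ltr01 R).
  by apply: le_trans; apply: rnorm_ge0.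
have S_lb : has_lbound S by exists 0 => r [].
pose d := inf S.
have d_ge0 : 0 <= d by apply: lb_le_inf; [exists M | move=> r []].
have near_d (eta : R) : 0 < eta ->
    forall e, 0 < e -> exists2 x, B e x & rnorm x < d + eta.
  move=> eta0 e e0.
  have [r [r0 /(_ e e0)[x Bx xr]] rd] :=
    inf_adherent eta0 (conj (ex_intro _ M SM) S_lb).
  by exists x => //; apply: le_lt_trans rd.
(* Otherwise [d - eta] would be an admissible radius below the infimum. *)
have above_d (eta : R) : 0 < eta ->
    exists2 e, 0 < e & forall x, B e x -> d - eta < rnorm x.
  move=> eta0; have [dn0|dn0] := ltP (d - eta) 0.
    by exists 1 => // x _; apply: lt_le_trans dn0 _; apply: rnorm_ge0.
  apply/not_exists2P => no_e.
  have : S (d - eta).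
    split=> // e e0; case: (no_e e) => //.
    move=> /existsNP[x /not_implyP[Bx /negP]]; rewrite -leNgt => xd.
    by exists x.
  by move=> /(ge_inf S_lb); rewrite -/d; lra.
pose G (eta : R) := [set x | B eta x /\ rnorm x < d + eta].
have G_mono (e f : R) : e <= f -> G e `<=` G f.
  by move=> ef x [/(B_mono _ _ ef) Bx xd]; split=> //; lra.
pose F := filter_from [set e : R | 0 < e] G.
have F_filter : Filter F.
  apply: filter_from_filter; first by exists 1 => /=.
  move=> e f /= e0 f0; exists (Num.min e f); first by rewrite /= lt_min e0 f0.
  move=> x Gx; split; apply: G_mono Gx; rewrite ge_min lexx ?orbT//.
have F_proper : ProperFilter F.
  apply: filter_from_proper => e /= e0.
  by have [x Bx xd] := near_d e e0 e e0; exists x.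
have F_cauchy : cauchy F.
  apply: cauchy_exP => eps eps0.
  have epsE : eps = (complex.Re eps)%:C%C by rewrite RRe_real ?gtr0_real.
  have r0 : 0 < complex.Re eps by rewrite -ltcR -epsE.
  set r := complex.Re eps in epsE r0.
  (* The parallelogram law will bound [|x - y|^2] by
     [16 d eta + 4 eta^2], which is below [16 (d + 1) eta] as [eta <= 1]. *)
  pose eta := Num.min 1 (r ^+ 2 / (16 * (d + 1))).
  have d16 : 0 < 16 * (d + 1) by lra.
  have eta0 : 0 < eta by rewrite lt_min ltr01 divr_gt0 ?exprn_gt0.
  have eta1 : eta <= 1 by rewrite ge_min lexx.
  have eta2 : eta * (16 * (d + 1)) <= r ^+ 2.
    by rewrite -ler_pdivlMr// ge_min lexx orbT.
  have [e e0 Be] := above_d eta eta0.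
  pose m := Num.min e eta.
  have m0 : 0 < m by rewrite lt_min e0 eta0.
  have me : m <= e by rewrite ge_min lexx.
  have meta : m <= eta by rewrite ge_min lexx orbT.
  have [x Bx xd] := near_d m m0 m m0.
  exists x; exists m => // y [By yd].
  rewrite -ball_normE /= rnormE epsE ltcR.
  have := Be _ (B_mono _ _ me _ (B_mid _ _ _ Bx By)).
  rewrite rnorm_half.
  have := rnorm_parallelogram dot_norm x y.
  have := rnorm_ge0 x; have := rnorm_ge0 y.
  have := rnorm_ge0 (x + y); have := rnorm_ge0 (x - y).
  move: (rnorm x) (rnorm y) (rnorm (x + y)) (rnorm (x - y)) xd yd.
  move=> a b c f ad bd f0 c0 b0 a0 para cd.
  have a2 : a ^+ 2 < (d + eta) ^+ 2 by rewrite ltr_pXn2r ?nnegrE//; lra.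
  have b2 : b ^+ 2 < (d + eta) ^+ 2 by rewrite ltr_pXn2r ?nnegrE//; lra.
  (* [2 (d - eta) < c] can be squared only if [eta <= d]; when [d < eta] the
     left side, [4 d (d - 2 eta)], is at most 0. *)
  have c2 : 4 * (d ^+ 2 - 2 * (d * eta)) <= c ^+ 2.
    have [dle|dgt] := leP eta d.
      have : (2 * (d - eta)) ^+ 2 <= c ^+ 2 by rewrite ler_pXn2r ?nnegrE//; lra.
      by have := sqr_ge0 eta; nra.
    have : 0 <= d * (2 * eta - d) by rewrite mulr_ge0//; lra.
    by have := sqr_ge0 c; nra.
  have : f ^+ 2 < r ^+ 2.
    have : eta * eta <= eta by rewrite ger_pMr.
    by nra.
  by rewrite ltr_pXn2r ?nnegrE// ltW.
have Flim : F --> lim F by apply: (cauchy_cvg F).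
exists (lim F) => e e0 U /Flim[eta /= eta0 GU].
have m0 : 0 < Num.min e eta by rewrite lt_min e0 eta0.
have [x Bx xd] := near_d _ m0 _ m0; exists x; split.
  by apply: B_mono Bx; rewrite ge_min lexx.
by apply: GU; apply: (G_mono (Num.min e eta)) => //; rewrite ge_min lexx orbT.
Qed.

(** A linear equation [E w = b] that has approximate solutions of bounded norm
    in a closed subspace has an exact one there. Without the norm bound only
    [b] in the closure of [E @` W] would follow. *)
Lemma bounded_approx_solution (R : realType) (H : completeNormedModType R[i])
    (dot : {dot H for @Num.conj R[i]}) (dot_norm : induces_norm dot)
    (E : {linear H -> H}) (W : set H) (b : H) (M : R)
    (E_cont : continuous E) (W_closed : closed W)
    (W_lin : forall (a : R[i]) x y, W x -> W y -> W (a *: (x + y)))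
    (approx : forall e, 0 < e ->
       exists w, [/\ W w, rnorm w <= M & rnorm (E w - b) < e]) :
  (E @` W) b.
Proof.
pose B (e : R) := [set w | W w /\ rnorm (E w - b) < e].
have [||e e0|w wB] := @bounded_convex_closure_meet _ _ _ dot_norm B M.
- by move=> e f ef w [Ww wb]; split=> //; apply: lt_le_trans ef.
- move=> e x y [Wx xb] [Wy yb]; split; first exact: W_lin.
  have -> : E (2^-1 *: (x + y)) - b = 2^-1 *: ((E x - b) + (E y - b)).
    rewrite linearZ linearD addrACA -opprD scalerBr; congr (_ - _).
    by rewrite -mulr2n -[b *+ 2]scaler_nat scalerA mulVf ?scale1r// pnatr_eq0.
  rewrite rnorm_half.
  by have := ler_rnormD (E x - b) (E y - b); lra.
- by have [w [Ww wM wb]] := approx e e0; exists w.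
exists w.
  have /closure_id -> := W_closed.
  by apply: closure_subset (wB 1 ltr01) => x [].
apply/eqP; rewrite -subr_eq0; apply/eqP/rnorm0_eq0/eqP.
rewrite eq_le rnorm_ge0 andbT; apply/ler_addgt0Pl => e e0; rewrite addr0.
have e20 : 0 < e / 2 by lra.
have /E_cont : nbhs (E w) [set y | rnorm (E w - y) < e / 2].
  by apply/nbhs_rnormP; exists (e / 2).
move=> /(wB _ e20)[x [[_ xb] /= xw]].
have := ler_rnormD (E w - E x) (E x - b); rewrite addrA subrK; lra.
Qed.

(** * Bounded operators and resolvents *)

(** Gives access to the lemmas on [{linear H -> H}] for an operator that is only
    known to be linear through a proposition. *)
Lemma bounded_operator_linear (R : realType) (H : normedModType R[i])
    (T : H -> H) :
  bounded_operator T ->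
  exists2 f : {linear H -> H}, T = f & bounded_near f (nbhs (0 : H)).
Proof.
move=> [T_lin T_bnd].
pose m := GRing.isLinear.Build _ _ _ _ T T_lin.
by exists (HB.pack T m : {linear H -> H}).
Qed.

Lemma bounded_operator_rnorm (R : realType) (H : normedModType R[i])
    (T : H -> H) :
  bounded_operator T -> exists2 c : R, 0 <= c & forall x, rnorm (T x) <= c * rnorm x.
Proof.
move=> /bounded_operator_linear[f -> /linear_boundedP/pinfty_ex_gt0[c c0 fc]].
have cE : c = (complex.Re c)%:C%C by rewrite RRe_real ?gtr0_real.
exists (complex.Re c); first by rewrite -ler0c -cE ltW.
by move=> x; have := fc x; rewrite !rnormE cE -rmorphM lecR.
Qed.

(** Boundedness matters because a supremum of an unbounded set is 0 by
    convention, so that [opnorm] bounds nothing for an unbounded [T]. *)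
Lemma rnorm_opnorm (R : realType) (H : normedModType R[i]) (T : H -> H) (x : H) :
  bounded_operator T -> rnorm (T x) <= opnorm T * rnorm x.
Proof.
move=> T_bnd; have [c c0 Tc] := bounded_operator_rnorm T_bnd.
have [f Tf _] := bounded_operator_linear T_bnd.
have [x0|x0] := eqVneq (rnorm x) 0.
  by rewrite (rnorm0_eq0 x0) Tf linear0 rnorm0 mulr0.
have xgt0 : 0 < rnorm x by rewrite lt_neqAle eq_sym x0 rnorm_ge0.
have vE : rnorm ((((rnorm x)^-1)%:C)%C : R[i]) = (rnorm x)^-1.
  by rewrite rnorm_real ger0_norm// invr_ge0 ltW.
rewrite -ler_pdivrMr// mulrC -vE -rnormZ Tf -linearZ -Tf.
apply: ub_le_sup; last first.
  by exists ((((rnorm x)^-1)%:C)%C *: x) => //=; rewrite rnormZ vE mulVf.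
exists c => _ [y /= y1 <-]; apply: le_trans (Tc y) _.
by rewrite -[leRHS]mulr1 ler_wpM2l.
Qed.

Lemma resolvent_cancel (R : realType) (H : normedModType R[i])
    (E A : H -> H) (s : R[i]) :
  rho E A s ->
  cancel (resolvent E A s) (pencil E A s) /\
  cancel (pencil E A s) (resolvent E A s).
Proof.
move=> [[g fg gf] _]; split=> x.
  by apply: pinvK; rewrite inE; exists (g x).
by apply: pinvKV; rewrite ?inE// => y z _ _; apply: (can_inj fg).
Qed.

Lemma ind_growth (R : realType) (H : normedModType R[i]) (E A : H -> H) (nu : R) :
  regular_on E A nu -> growth_exponents E A nu (ind E A nu).
Proof.
move=> [_ [k0 k0P]]; have exP : exists k, `[< growth_exponents E A nu k >].
  by exists k0; apply/asboolP.
suff [] : [set k | growth_exponents E A nu k /\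
    forall j, growth_exponents E A nu j -> (k <= j)%N] (ind E A nu) by [].
apply: xgetPex; case: (ex_minnP exP) => k /asboolP kP kmin.
by exists k; split=> // j jP; apply: kmin; apply/asboolP.
Qed.

(** * Initial value spaces *)

Lemma IV0 (R : realType) (H : normedModType R[i]) (E A : {linear H -> H}) j :
  IV E A j 0.
Proof. by elim: j => //= j IVj; exists 0; rewrite ?linear0. Qed.

Lemma IV_lin (R : realType) (H : normedModType R[i]) (E A : {linear H -> H}) j
    (a : R[i]) x y :
  IV E A j x -> IV E A j y -> IV E A j (a *: (x + y)).
Proof.
elim: j x y => [//|j IHj] x y /= [u IVu uE] [v IVv vE].
by exists (a *: (u + v)); [exact: IHj | rewrite !linearZ !linearD uE vE].
Qed.

Lemma IV_subset (R : realType) (H : normedModType R[i]) (E A : H -> H) j :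
  IV E A j.+1 `<=` IV E A j.
Proof.
elim: j => [//|j IHj] x [u IVu uE].
by exists u => //; apply: IHj.
Qed.

Lemma IV_closed (R : realType) (H : normedModType R[i]) (E A : H -> H) j :
  continuous A -> closed (E @` IV E A j) -> closed (IV E A j.+1).
Proof. by move=> A_cont; apply: preimage_closed => x _; apply: A_cont. Qed.

(** Solving with the pencil gains one level: [A w = E (y - s w)], where
    [y - s w] is in [IV j] as soon as [y] and [w] are. *)
Lemma pencil_IV (R : realType) (H : normedModType R[i]) (E A : {linear H -> H})
    (s : R[i]) j w y :
  pencil E A s w = E y -> IV E A j y -> IV E A j.+1 w.
Proof.
rewrite /pencil => wy.
have Aw : A w = E (y + (- s) *: w).
  by rewrite linearD linearZ /= -wy scaleNr addrAC subrr add0r.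
elim: j => [_|j IHj IVy]; first by exists (y + (- s) *: w).
exists (y + (- s) *: w) => //.
have IVw : IV E A j.+1 ((- s) *: (w + 0)).
  apply: IV_lin; first by apply/IHj/IV_subset.
  exact: IV0.
by rewrite -[_ + _]scale1r; apply: IV_lin => //; move: IVw; rewrite addr0.
Qed.

(** Induction on [j] through [s R(s) E x = x - R(s) A x]. For [j = 0] the growth
    hypothesis bounds [R(s) A x]. If [A x = E u] with [u] in [IV j], the last
    term is [R(s) E u], which the induction hypothesis bounds by
    [C |s|^(k - j) / |s|]. *)
Lemma resolvent_IV_growth (R : realType) (H : normedModType R[i])
    (E A : {linear H -> H}) (nu : R) (k : nat)
    (half_rho : half_plane nu `<=` rho E A)
    (k_growth : growth_exponents E A nu k) (j : nat) (x : H) :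
  (j <= k)%N -> IV E A j x ->
  exists2 C : R, 0 <= C & forall s, half_plane nu s -> 1 <= rnorm s ->
    rnorm (s *: resolvent E A s (E x)) <= C * rnorm s ^+ (k - j).
Proof.
have [C0 C00 RC0] := k_growth.
have key s y : half_plane nu s ->
    s *: resolvent E A s (E y) = y - resolvent E A s (A y).
  move=> nus; have [RK KR] := resolvent_cancel (half_rho _ nus).
  have [f Rf _] := bounded_operator_linear (half_rho _ nus).2.
  rewrite Rf -linearZ; apply/eqP; rewrite -subr_eq0 opprB addrA.
    by rewrite subr_eq0 -linearD -Rf -[_ + A y]/(pencil E A s y) KR.
elim: j x => [|j IHj] x jk.
  move=> _; exists (rnorm x + C0 * rnorm (A x)).
    by rewrite addr_ge0 ?mulr_ge0 ?rnorm_ge0.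
  move=> s nus s1; rewrite key// subn0.
  apply: le_trans (ler_rnormB _ _) _; rewrite mulrDl lerD//.
    by rewrite ler_peMr ?rnorm_ge0// exprn_ege1.
  apply: le_trans (rnorm_opnorm _ (half_rho _ nus).2) _.
  by rewrite mulrAC ler_wpM2r ?rnorm_ge0// RC0.
move=> [u IVu uE]; have [C C_ge0 uC] := IHj u (ltnW jk) IVu.
exists (rnorm x + C); first by rewrite addr_ge0 ?rnorm_ge0.
move=> s nus s1; rewrite key// -uE.
apply: le_trans (ler_rnormB _ _) _; rewrite mulrDl lerD//.
  by rewrite ler_peMr ?rnorm_ge0// exprn_ege1.
have := uC s nus s1; rewrite rnormZ.
have -> : (k - j = (k - j.+1).+1)%N by rewrite subnSK.
by rewrite exprS mulrCA ler_pM2l//; lra.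
Qed.

(** The approximate solution is [s R(s) E y] for a large real [s]. Here [j = k]
    in [resolvent_IV_growth], so its norm is at most [M], while the error
    [- A R(s) E y] is at most [c M / s] where [c] bounds [A]. *)
Lemma resolvent_IV_approx (R : realType) (H : normedModType R[i])
    (E A : {linear H -> H}) (nu : R) (k : nat)
    (A_bnd : bounded_operator A)
    (half_rho : half_plane nu `<=` rho E A)
    (k_growth : growth_exponents E A nu k) (y : H) :
  IV E A k y ->
  exists M : R, forall e, 0 < e ->
    exists w, [/\ IV E A k.+1 w, rnorm w <= M & rnorm (E w - E y) < e].
Proof.
move=> IVy; have [M M0 yM] := resolvent_IV_growth half_rho k_growth (leqnn k) IVy.
exists M => e e0; have [c c0 Ac] := bounded_operator_rnorm A_bnd.
(* [t > nu] puts [t] in the half-plane and [t > c M / e] makes the error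
   smaller than [e]; the two units give [1 <= t] and strictness. *)
pose t := `|nu| + 1 + (c * M + 1) / e.
have cM : 0 <= c * M by rewrite mulr_ge0.
have t1 : 1 <= t.
  rewrite /t -addrA addrCA lerDl addr_ge0// divr_ge0 ?ltW//; lra.
have nut : half_plane nu (t%:C)%C.
  rewrite /half_plane /= /t; have := ler_norm nu.
  have : 0 <= (c * M + 1) / e by rewrite divr_ge0 ?ltW//; lra.
  lra.
have tE : rnorm (t%:C)%C = t by rewrite rnorm_real ger0_norm//; lra.
have := yM _ nut; rewrite tE => /(_ t1); rewrite subnn mulr1.
set v := resolvent E A _ _ => vM.
have [RK _] := resolvent_cancel (half_rho _ nut).
have vE : pencil E A (t%:C)%C v = E y by rewrite RK.
exists ((t%:C)%C *: v); split=> //.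
  have -> : (t%:C)%C *: v = (t%:C)%C *: (v + 0) by rewrite addr0.
  apply: IV_lin; first exact: pencil_IV vE IVy.
  exact: IV0.
rewrite linearZ -vE /pencil opprD addrA subrr add0r rnormN.
have t0 : 0 < t by lra.
have vMt : rnorm v <= M / t by rewrite ler_pdivlMr// mulrC -{1}tE -rnormZ.
apply: le_lt_trans (Ac v) _.
apply: (@le_lt_trans _ _ (c * (M / t))); first exact: ler_wpM2l.
rewrite mulrA ltr_pdivrMr// /t !mulrDr mulrCA divff ?gt_eqF// mulr1.
have := mulr_ge0 (ltW e0) (normr_ge0 nu); lra.
Qed.

(** * Stabilisation of the initial value spaces *)

Theorem proposition1p1 (R : realType) (H : completeNormedModType R[i])
    (dot : {dot H for @Num.conj R[i]}) (dot_norm : induces_norm dot)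
    (E A : H -> H)
    (E_bounded : bounded_operator E) (A_bounded : bounded_operator A)
    (EA_regular : regular E A)
    (nu0 : R) (nu0_regular : regular_on E A nu0)
    (EIV_closed : closed (E @` IV E A (ind E A nu0))) :
  IV E A (ind E A nu0).+1 = IV E A (ind E A nu0).+2.
Proof.
apply/seteqP; split; last exact: IV_subset.
have k_growth := ind_growth nu0_regular.
have [half_rho _] := nu0_regular.
move: (ind E A nu0) EIV_closed k_growth => k EIV_closed k_growth.
have [E' EE' /bounded_linear_continuous E_cont] := bounded_operator_linear E_bounded.
have [A' AA' /bounded_linear_continuous A_cont] := bounded_operator_linear A_bounded.
subst E A => x [y IVy yx].
have [M approx] := resolvent_IV_approx A_bounded half_rho k_growth IVy.
rewrite -[IV _ _ _]/[set x | (E' @` IV E' A' k.+1) (A' x)] /= -yx.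
apply: (bounded_approx_solution dot_norm E_cont _ _ approx).
  exact: IV_closed A_cont EIV_closed.
by move=> a u v; apply: IV_lin.
Qed.
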